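(* Let $\mathbf f\in L^\infty(0,t^*;\mathbf H^{-1}(\Omega))$, $\gamma\in L^\infty(0,t^*;H^{-1}(\Omega))$, and let the initial conditions satisfy $\mathbf u_h^1,\mathbf u_h^0\in\mathbf V_h$, $T_h^1,T_h^0\in Y_h$. Then, for every $\Delta t>0$ (with $t^*=M\Delta t$), solutions $(\mathbf u_h^n,p_h^n,T_h^n)$ of the linearized BDF2 finite element scheme for the Leray--Boussinesq model with adaptive nonlinear filter (the Algorithm stated in the context) satisfy $$ \|\mathbf u_h^{M}\|^2+\|T_h^{M}\|^2+\|2\mathbf u_h^{M}-\mathbf u_h^{M-1}\|^2+\|2T_h^{M}-T_h^{M-1}\|^2+2Re^{-1}\Delta t\sum_{n=0}^{M-1}\|\nabla\mathbf u_h^{n+1}\|^2+2(Re\,Pr)^{-1}\Delta t\sum_{n=0}^{M-1}\|\nabla T_h^{n+1}\|^2 $$ $$ \le \|\mathbf u_h^1\|^2+\|T_h^1\|^2+\|2\mathbf u_h^1-\mathbf u_h^0\|^2+\|2T_h^1-T_h^0\|^2+4Re\,\Delta t\sum_{n=0}^{M-1}\|\mathbf f^{n+1}\|_{-1}^2+2Re\,Pr\,\Delta t\sum_{n=0}^{M-1}\|\gamma^{n+1}\|_{-1}^2+4\,C_P^2\,Ri^2\,Re\,C_T\,t^*, $$ where $$ C_T:=\|T_h^1\|^2+\|2T_h^1-T_h^0\|^2+2Re\,Pr\,\Delta t\sum_{n=0}^{M-1}\|\gamma^{n+1}\|_{-1}^2 . $$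
   Context: **Setting.** $\Omega\subset\mathbb R^d$ ($d=2$ or $3$) is a convex polygon or polyhedron; $\|\cdot\|$ and $(\cdot,\cdot)$ are the $L^2(\Omega)$ norm and inner product. $Re,Ri,Pr$ are the Reynolds, Richardson and Prandtl numbers, and $\hat{\mathbf k}=\langle 0,\ldots,0,1\rangle$ is the last unit vector of $\mathbb R^d$. Set $\mathbf X=(H_0^1(\Omega))^d$, $Q=L_0^2(\Omega)$ (mean-zero $L^2$ functions), $Y=H_0^1(\Omega)$. $C_P=C_P(\Omega)$ is the Poincaré--Friedrichs constant: $\|\mathbf v\|\le C_P\|\nabla\mathbf v\|$ for all $\mathbf v\in\mathbf X$. The dual norm is $\|\mathbf f\|_{-1}=\sup_{0\ne\mathbf v\in\mathbf X}|(\mathbf f,\mathbf v)|/\|\nabla\mathbf v\|$ on $\mathbf H^{-1}(\Omega)=\mathbf X'$, and similarly on $H^{-1}(\Omega)=Y'$ with $Y$ in place of $\mathbf X$. **Finite element spaces.** $\mathbf X_h\subset\mathbf X$, $Q_h\subset Q$, $Y_h\subset Y$ are conforming finite element spaces on a regular mesh $\tau_h$ with maximum element diameter $h$, consisting of piecewise polynomials of local degree $k$, $k-1$, $k$ respectively. The pair $(\mathbf X_h,Q_h)$ satisfies the discrete inf-sup condition $\inf_{q_h\in Q_h}\sup_{\mathbf v_h\in\mathbf X_h}\frac{(q_h,\nabla\cdot\mathbf v_h)}{\|\nabla\mathbf v_h\|\,\|q_h\|}\ge\beta>0$ with $\beta$ independent of $h$. The discretely divergence-free space is $\mathbf V_h=\{\mathbf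 v_h\in\mathbf X_h:(q_h,\nabla\cdot\mathbf v_h)=0\ \forall q_h\in Q_h\}$. **Trilinear forms.** $b(\mathbf u,\mathbf v,\mathbf w)=\frac12[(\mathbf u\cdot\nabla\mathbf v,\mathbf w)-(\mathbf u\cdot\nabla\mathbf w,\mathbf v)]$ for $\mathbf u,\mathbf v,\mathbf w\in\mathbf X$, and $c(\mathbf u,\theta,\psi)=\frac12[(\mathbf u\cdot\nabla\theta,\psi)-(\mathbf u\cdot\nabla\psi,\theta)]$ for $\mathbf u\in\mathbf X$, $\theta,\psi\in Y$. **Filters.** Let $\alpha>0$ be the filtering radius, $\alpha\le\mathcal O(h)$, and $N\ge0$ an integer. The discrete Helmholtz filter $F_h\psi=\widetilde\psi_h$ of a scalar $\psi\in L^2(\Omega)$ is the element of the scalar finite element space of velocity components satisfying $\alpha^2(\nabla\widetilde\psi_h,\nabla v_h)+(\widetilde\psi_h,v_h)=(\psi,v_h)$ for all $v_h$ in that space; for vector fields it is applied to each component. The discrete van Cittert deconvolution operator is $D_N^h=\sum_{n=0}^N(I-F_h)^n$, and the indicator function is $a_{D_N}(\mathbf u)(x)=|\mathbf u(x)-D_N^h\widetilde{\mathbf u}_h(x)|$, for which the standing assumption is $a_{D_N}(\mathbf u)(x)\le1$. The adaptively filtered velocity $\overline{\mathbf u}^h\in\mathbf V_h$ of $\mathbf u$ is the solution of $\alpha^2(a_{D_N}(\mathbf u)\nabla\overline{\mathbf u}^h,\nabla\mathbf v_h)+(\overline{\mathbf u}^h,\mathbf v_h)=(\mathbf u,\mathbf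 v_h)$ for all $\mathbf v_h\in\mathbf V_h$. **Algorithm.** Let $t^*=M\Delta t$, $t^n=n\Delta t$, $\mathbf f^n=\mathbf f(t^n)$, $\gamma^n=\gamma(t^n)$. Given $\mathbf u_h^0,\mathbf u_h^1,T_h^0,T_h^1$, for $n=1,\ldots,M-1$ find $(\mathbf u_h^{n+1},p_h^{n+1},T_h^{n+1})\in\mathbf X_h\times Q_h\times Y_h$ such that for all $(\mathbf v_h,q_h,s_h)\in\mathbf X_h\times Q_h\times Y_h$: $$\tfrac1{2\Delta t}(3T_h^{n+1}-4T_h^n+T_h^{n-1},s_h)+c(2\mathbf u_h^n-\mathbf u_h^{n-1},T_h^{n+1},s_h)+(Re\,Pr)^{-1}(\nabla T_h^{n+1},\nabla s_h)=(\gamma^{n+1},s_h),$$ $$\tfrac1{2\Delta t}(3\mathbf u_h^{n+1}-4\mathbf u_h^n+\mathbf u_h^{n-1},\mathbf v_h)+b\big(\overline{2\mathbf u_h^n-\mathbf u_h^{n-1}}^h,\mathbf u_h^{n+1},\mathbf v_h\big)+Re^{-1}(\nabla\mathbf u_h^{n+1},\nabla\mathbf v_h)-(p_h^{n+1},\nabla\cdot\mathbf v_h)-Ri((2T_h^n-T_h^{n-1})\hat{\mathbf k},\mathbf v_h)=(\mathbf f^{n+1},\mathbf v_h),$$ $$(\nabla\cdot\mathbf u_h^{n+1},q_h)=0.$$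
   Formalization: The two gradient sums on the left run over n=1,…,M−1 instead of n=0,…,M−1: the printed n=0 terms, in the gradients of the initial data u_h^1 and T_h^1, are not controlled by the right side (f=γ=T=0, u_h^0=u_h^1≠0, large Δt violates the printed bound). *)

(* Defs.v *)
From HB Require Import structures.
From mathcomp Require Import all_boot all_order all_algebra.
From mathcomp Require Import all_classical all_reals all_analysis.

Set Implicit Arguments.
Unset Strict Implicit.
Unset Printing Implicit Defensive.

Import Order.TTheory GRing.Theory Num.Theory.
Import numFieldNormedType.Exports.

Local Open Scope classical_set_scope.
Local Open Scope ring_scope.

(* Conventions. A point of R^d is a row vector 'rV[R]_d, a scalar field is a
   function 'rV[R]_d -> R and a vector field a function 'rV[R]_d -> 'rV[R]_d.
   Elements of L^2(Om) and of the Sobolev and finite element spaces are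
   represented by functions defined on all of R^d; only their restriction to
   Om matters, and "nonzero" for such an element means nonzero L^2 norm. *)

Section row_measurable.
Context {R : realType} (n : nat).

Definition row_display : measure_display. Proof. exact. Qed.

Let coords : 'I_n -> 'rV[R]_n -> measurableTypeR R := fun i x => x ord0 i.

Let row_set0 : g_sigma_preimage coords set0.
Proof. exact: sigma_algebra0. Qed.

Let row_setC A : g_sigma_preimage coords A -> g_sigma_preimage coords (~` A).
Proof. exact: sigma_algebraC. Qed.

Let row_bigcup (F : _^nat) : (forall i, g_sigma_preimage coords (F i)) ->
  g_sigma_preimage coords (\bigcup_i (F i)).
Proof. exact: sigma_algebra_bigcup. Qed.

HB.instance Definition _ := @isMeasurable.Build row_display
  'rV[R]_n (g_sigma_preimage coords) row_set0 row_setC row_bigcup.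

Lemma measurable_coord (i : 'I_n) :
  measurable_fun [set: 'rV[R]_n] (fun x => x ord0 i : R).
Proof.
move=> _ Y mY; rewrite setTI; apply: sub_sigma_algebra => /=.
rewrite -bigcup_seq/=; exists i => /=; first by rewrite mem_index_enum.
by exists Y => //; rewrite setTI.
Qed.

Lemma measurable_fun_row d (T : measurableType d) (f : T -> 'rV[R]_n) :
  (forall i,
    measurable_fun [set: T] (fun t => f t ord0 i : measurableTypeR R)) ->
  measurable_fun [set: T] f.
Proof.
move=> mf _ A mA; rewrite setTI; move: A mA.
suff: g_sigma_preimage coords `<=` [set A | measurable (f @^-1` A)] by [].
apply: smallest_sub => /=.
  split=> [|A /= mA|F /= mF].
  - by rewrite /= preimage_set0.
  - by rewrite setTD preimage_setC; exact: measurableC.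
  - by rewrite preimage_bigcup; exact: bigcup_measurable.
rewrite -bigcup_seq => A [i _] [B mB <-] /=.
by rewrite setTI; have := mf i measurableT B mB; rewrite setTI.
Qed.

End row_measurable.

Section lebesgue_row.
Context {R : realType}.

Definition row_cons n (p : measurableTypeR R * 'rV[R]_n) : 'rV[R]_n.+1 :=
  \row_i oapp (fun j => p.2 ord0 j) p.1 (unlift ord0 i).

Lemma measurable_row_cons n : measurable_fun setT (@row_cons n).
Proof.
apply: measurable_fun_row => i.
under [X in measurable_fun _ X]eq_fun do rewrite mxE.
case: unliftP => [j|] _ /=; last exact: measurable_fst.
by apply: (measurableT_comp (measurable_coord j)); exact: measurable_snd.
Qed.

Definition lebesgue_prod n (m : {measure set 'rV[R]_n -> \bar R}) :
    set 'rV[R]_n.+1 -> \bar R :=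
  pushforward (lebesgue_measure \x^ m)%E (@row_cons n).

HB.instance Definition _ n (m : {measure set 'rV[R]_n -> \bar R}) :=
  Measure.copy (lebesgue_prod m)
    (measure_function_pushforward__canonical__measure_function_Measure
       (lebesgue_measure \x^ m)%E (@measurable_row_cons n)).

Fixpoint lebesgue_row (n : nat) : {measure set 'rV[R]_n -> \bar R} :=
  match n with
  | 0 => dirac (0 : 'rV[R]_0)
  | n'.+1 => lebesgue_prod (lebesgue_row n')
  end.

Lemma lebesgue_row_box n (A : 'I_n -> set (measurableTypeR R)) :
  (forall i, measurable (A i)) ->
  lebesgue_row n [set x | forall i, A i (x ord0 i)] =
  (\prod_(i < n) lebesgue_measure (A i))%E.
Proof.
elim: n A => [A _|m IH A mA] /=.
  by rewrite big_ord0 diracE mem_set//= => -[].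
rewrite /lebesgue_prod /pushforward.
have -> : @row_cons m @^-1` [set x | forall i, A i (x ord0 i)] =
    A ord0 `*` [set x : 'rV[R]_m | forall i, A (lift ord0 i) (x ord0 i)].
  apply/seteqP; split=> -[a x] /=.
    move=> H; split=> [|i]; first by have := H ord0; rewrite mxE unlift_none.
    by have := H (lift ord0 i); rewrite mxE liftK.
  move=> [Aa Ax] i; rewrite mxE.
  by case: unliftP => [j ->|->] //=.
have mB : measurable [set x : 'rV[R]_m | forall i, A (lift ord0 i) (x ord0 i)].
  rewrite (_ : mkset _ = \bigcap_(i in setT)
    ((fun x : 'rV[R]_m => x ord0 i) @^-1` A (lift ord0 i))).
    apply: fin_bigcap_measurable => // i _.
    by have := measurable_coord i measurableT (mA (lift ord0 i)); rewrite setTI.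
  by apply/seteqP; split=> x /= H i; [move=> _; exact: H|exact: (H i I)].
rewrite product_measure2E// big_ord_recl; congr (_ * _)%E.
by rewrite -IH.
Qed.

End lebesgue_row.

Section domain_and_mesh.
Context {R : realType} {d : nat}.
Implicit Types (x y a : 'rV[R]_d) (K F Om : set 'rV[R]_d).

Definition dotp x y : R := \sum_i x ord0 i * y ord0 i.
Definition enorm x : R := Num.sqrt (dotp x x).

(* Bounded open convex polygon (d = 2) or polyhedron (d = 3). *)
Definition convex_polytope_domain Om :=
  [/\ Om !=set0, bounded_set Om &
      exists (m : nat) (a : 'I_m -> 'rV[R]_d) (b : 'I_m -> R),
        Om = [set x | forall i, dotp (a i) x < b i]].

Definition conv_hull (s : seq 'rV[R]_d) : set 'rV[R]_d :=
  [set x | exists w : 'I_(size s) -> R,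
     [/\ forall i, 0 <= w i, \sum_i w i = 1 & x = \sum_i w i *: s`_i]].

(* Triangles and tetrahedra are the special case of d+1 vertices. *)
Definition element K := (exists s, K = conv_hull s) /\ interior K !=set0.

(* A proper, possibly empty, face of K. *)
Definition face F K := exists (a : 'rV[R]_d) (b : R),
  [/\ a != 0, forall x, K x -> dotp a x <= b &
      F = [set x | K x /\ dotp a x = b]].

Definition diameter K : R :=
  sup [set r | exists x y, [/\ K x, K y & r = enorm (x - y)]].

(* tau is a conforming mesh of Om of maximum element diameter h, regular in
   Ciarlet's sense: the ratio of the diameter of an element to the radius of a
   ball that it contains is bounded by sigma. *)
Definition regular_mesh Om (sigma h : R) (tau : set (set 'rV[R]_d)) :=
  [/\ finite_set tau,
      \bigcup_(K in tau) K = closure Om,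
      forall K, tau K -> element K,
      forall K K', tau K -> tau K' -> K <> K' ->
        face (K `&` K') K /\ face (K `&` K') K' &
      [/\ forall K, tau K -> diameter K <= h,
          exists2 K, tau K & diameter K = h &
          forall K, tau K -> exists (c : 'rV[R]_d) (rho : R),
            [/\ 0 < rho, forall x, enorm (x - c) <= rho -> K x &
                diameter K <= sigma * rho]]].

(* Polynomials in d variables of total degree at most k. *)
Definition poly_fun (k : nat) (p : 'rV[R]_d -> R) :=
  exists c : {ffun 'I_d -> 'I_k.+1} -> R,
    p = fun x => \sum_(m : {ffun 'I_d -> 'I_k.+1} | (\sum_i m i <= k)%N)
                   c m * \prod_i x ord0 i ^+ m i.

Definition piecewise_poly (tau : set (set 'rV[R]_d)) (k : nat)
    (v : 'rV[R]_d -> R) :=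
  forall K, tau K ->
    exists2 p, poly_fun k p & forall x, interior K x -> v x = p x.

End domain_and_mesh.

Section sobolev.
Context {R : realType} {d : nat}.
Variable Om : set 'rV[R]_d.

Local Notation point := 'rV[R]_d.
Local Notation scalar := ('rV[R]_d -> R).
Local Notation vfield := ('rV[R]_d -> 'rV[R]_d).
Local Notation mu := (lebesgue_row d).

Implicit Types (f g v w q phi theta psi : scalar) (U V W : vfield).

Definition ip f g : R := \int[mu]_(x in Om) (f x * g x).
Definition l2norm f : R := Num.sqrt (ip f f).

Definition L2 : set scalar :=
  [set f : scalar | measurable_fun Om f /\
           mu.-integrable Om (EFin \o (fun x => f x ^+ 2))].

Definition L20 : set scalar :=
  [set q | L2 q /\ \int[mu]_(x in Om) q x = 0].

Definition partial (i : 'I_d) phi : scalar :=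
  fun x => 'D_(delta_mx ord0 i : point) phi x.

(* C^oo functions with compact support in Om. *)
Definition test_fun phi :=
  (forall (s : seq 'I_d) (x : point), differentiable (foldr partial phi s) x) /\
  exists2 K : set point, compact K & K `<=` Om /\ forall x, ~ K x -> phi x = 0.

Definition is_weak_partial (i : 'I_d) v g :=
  L2 g /\ forall phi, test_fun phi -> ip v (partial i phi) = - ip g phi.

(* The weak derivative is determined up to a null set; a representative is
   chosen, and functions without a weak derivative in L^2 are sent to 0. *)
Definition wpartial (i : 'I_d) v : scalar := xget 0 (is_weak_partial i v).

Definition H1 : set scalar :=
  [set v | L2 v /\ forall i, exists g, is_weak_partial i v g].

(* Closure of the test functions in H^1. *)
Definition H01 : set scalar :=
  [set v | H1 v /\ exists phi : nat -> scalar,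
     [/\ forall n, test_fun (phi n),
         l2norm (phi n - v) @[n --> \oo] --> 0 &
         forall i,
           l2norm (partial i (phi n) - wpartial i v) @[n --> \oo] --> 0]].

Definition gradip v w : R := \sum_i ip (wpartial i v) (wpartial i w).
Definition gradnorm v : R := Num.sqrt (gradip v v).

Definition component U (i : 'I_d) : scalar := fun x => U x ord0 i.

(* The fields with all components in S: (H_0^1)^d for S = H_0^1. *)
Definition vfields (S : set scalar) : set vfield :=
  [set U | forall i, S (component U i)].

Definition vip U V : R := \sum_i ip (component U i) (component V i).
Definition vnorm U : R := Num.sqrt (vip U U).
Definition vgradip U V : R := \sum_i gradip (component U i) (component V i).
Definition vgradnorm U : R := Num.sqrt (vgradip U U).

(* (a grad U, grad V) for a scalar weight a. *)
Definition wvgradip (a : scalar) U V : R :=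
  \sum_i \sum_j
    ip (fun x => a x * wpartial j (component U i) x)
       (wpartial j (component V i)).

Definition divergence U : scalar := \sum_i wpartial i (component U i).

Definition advect U theta : scalar :=
  fun x => \sum_i U x ord0 i * wpartial i theta x.

Definition cform U theta psi : R :=
  2^-1 * (ip (advect U theta) psi - ip (advect U psi) theta).

Definition bform U V W : R :=
  2^-1 * (\sum_i ip (advect U (component V i)) (component W i) -
          \sum_i ip (advect U (component W i)) (component V i)).

Definition poincare (C : R) :=
  forall V, vfields H01 V -> vnorm V <= C * vgradnorm V.

End sobolev.

(* The dual of a space X of fields on which nrm is the L^2 norm and gn the L^2
   norm of the gradient. *)
Section dual.
Context {R : realType} {V : lmodType R}.
Variables (X : set V) (nrm gn : V -> R).

Definition dual_space (f : V -> R) :=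
  (forall a v w, X v -> X w -> f (a *: v + w) = a * f v + f w) /\
  exists C : R, forall v, X v -> `|f v| <= C * gn v.

Definition dual_norm (f : V -> R) : R :=
  sup [set `|f v| / gn v | v in [set v | X v /\ nrm v != 0]].

(* L^oo(0, tmax; X'). As the scheme evaluates F at the time nodes, F is a
   function defined at every t in ]0, tmax], not a class of functions. Weak
   measurability is Bochner measurability here, X' being separable. *)
Definition Linfty_dual (tmax : R) (F : R -> V -> R) :=
  [/\ forall t, 0 < t <= tmax -> dual_space (F t),
      forall v, X v -> measurable_fun `]0, tmax[ (fun t => F t v) &
      exists C : R, {ae lebesgue_measure, forall t : measurableTypeR R,
        0 < t < tmax -> dual_norm (F t) <= C}].

End dual.

Section discretization.
Context {R : realType} {d : nat}.
Variable Om : set 'rV[R]_d.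

Local Notation scalar := ('rV[R]_d -> R).
Local Notation vfield := ('rV[R]_d -> 'rV[R]_d).

Implicit Types (S Qh Yh : set scalar) (U V : vfield).

Definition lin_subspace S :=
  S 0 /\ forall (a : R) v w, S v -> S w -> S (a *: v + w).

Definition fe_space (B : set scalar) (tau : set (set 'rV[R]_d)) (k : nat) S :=
  [/\ lin_subspace S, S `<=` B & forall v, S v -> piecewise_poly tau k v].

Definition inf_sup (Xh : set vfield) Qh (beta : R) :=
  (beta%:E <= ereal_inf
     [set ereal_sup
        [set (ip Om q (divergence Om V) / (vgradnorm Om V * l2norm Om q))%R%:E
           | V in [set V | Xh V /\ (vnorm Om V != 0)%R]]
        | q in [set q | Qh q /\ (l2norm Om q != 0)%R]])%E.

Definition disc_div_free (Xh : set vfield) Qh : set vfield :=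
  [set V | Xh V /\ forall q, Qh q -> ip Om q (divergence Om V) = 0].

(* S is the scalar finite element space of the velocity components. *)
Definition helmholtz_filter (alpha : R) S (psi : scalar) : scalar :=
  xget 0 [set w | S w /\ forall v, S v ->
    alpha ^+ 2 * gradip Om w v + ip Om w v = ip Om psi v].

Definition deconv (alpha : R) S (N : nat) (psi : scalar) : scalar :=
  \sum_(0 <= n < N.+1)
    iter n (fun w => w - helmholtz_filter alpha S w) psi.

Definition componentwise (G : scalar -> scalar) U : vfield :=
  fun x => \row_i G (component U i) x.

Definition filter_indicator (alpha : R) S (N : nat) U : scalar :=
  fun x => enorm (U x - componentwise (deconv alpha S N)
                          (componentwise (helmholtz_filter alpha S) U) x).

Definition adaptive_filter (alpha : R) S Qh (N : nat) U : vfield :=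
  xget 0 [set W | disc_div_free (vfields S) Qh W /\
    forall V, disc_div_free (vfields S) Qh V ->
      alpha ^+ 2 * wvgradip Om (filter_indicator alpha S N U) W V + vip Om W V =
      vip Om U V].

Definition khat : 'rV[R]_d := \row_i ((i.+1 == d)%:R).

Definition extrapolate (A : lmodType R) (z : nat -> A) (n : nat) : A :=
  2 *: z n - z n.-1.

Definition bdf2 (A : lmodType R) (z : nat -> A) (n : nat) : A :=
  3 *: z n.+1 - 4 *: z n + z n.-1.

(* The linearized BDF2 scheme with time step dt and M steps; the pairing
   (f^{n+1}, v) is the duality pairing f (t^{n+1}) v. *)
Definition leray_boussinesq_bdf2 (Re Ri Pr alpha : R) (N : nat) S Qh Yh
    (dt : R) (M : nat) (f : R -> vfield -> R) (gamma : R -> scalar -> R)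
    (u : nat -> vfield) (p T : nat -> scalar) :=
  forall n, (1 <= n < M)%N ->
  [/\ vfields S (u n.+1), Qh (p n.+1), Yh (T n.+1) &
   forall v q s, vfields S v -> Qh q -> Yh s ->
   [/\ (2 * dt)^-1 * ip Om (bdf2 T n) s
         + cform Om (extrapolate u n) (T n.+1) s
         + (Re * Pr)^-1 * gradip Om (T n.+1) s
       = gamma (n.+1%:R * dt) s,
       (2 * dt)^-1 * vip Om (bdf2 u n) v
         + bform Om (adaptive_filter alpha S Qh N (extrapolate u n)) (u n.+1) v
         + Re^-1 * vgradip Om (u n.+1) v
         - ip Om (p n.+1) (divergence Om v)
         - Ri * vip Om (fun x => extrapolate T n x *: khat) v
       = f (n.+1%:R * dt) v &
       ip Om (divergence Om (u n.+1)) q = 0]].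

End discretization.

(* Main.v *)
Require Import Defs.
From mathcomp Require Import all_boot all_order all_algebra.
From mathcomp Require Import all_classical all_reals all_analysis.
From mathcomp Require Import measurable_realfun ring lra.

Set Implicit Arguments.
Unset Strict Implicit.
Unset Printing Implicit Defensive.

Import Order.TTheory GRing.Theory Num.Theory.
Import numFieldNormedType.Exports.

Local Open Scope classical_set_scope.
Local Open Scope ring_scope.

(** The proof is the energy method. Each equation of the scheme is tested with
the unknown of the new time level. The convective terms then vanish, because
[cform] and [bform] are skew-symmetric in their last two arguments whatever the
advecting field is, and so does the pressure term, because the new velocity is
discretely divergence free. The discrete time derivative is controlled by the
identity for the second order backward difference, valid for any symmetric
bilinear form:

  2 (3a - 4b + c, a) = |a|^2 + |2a - b|^2 - |b|^2 - |2b - c|^2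
                       + |a - 2b + c|^2.

Each step thus bounds the increment of |z_n|^2 + |2 z_n - z_(n-1)|^2
plus the dissipation by a load of the form (coefficient) * |grad z_(n+1)|;
Young's inequality absorbs the gradient in half of the dissipation and a
telescoping sum concludes. This is [bdf2_stability], which is used twice.

For the temperature the coefficient is the dual norm of the heat source. The
resulting bound holds at every time level, so the extrapolated temperature that
drives the buoyancy satisfies |2 T_n - T_(n-1)|^2 <= C_T
([extrapolation_bound]). For the velocity the coefficient is the dual norm of
the body force plus |Ri| C_P |2 T_n - T_(n-1)|, by the Cauchy-Schwarz and
Poincare inequalities; its square is at most twice the sum of the squares,
whence the constants 4 in the final bound.

One point of functional analysis is hidden in the duality estimate
|f(v)| <= |f|_(-1) |grad v|. The dual norm is a supremum over the v of nonzero
L^2 norm, while weak gradients are arbitrary representatives, so one must know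
that |v| = 0 implies |grad v| = 0 ([gradnorm_null]). Since v is a limit in H^1
of test functions phi_n, a weak derivative g of v is the L^2 limit of the
d_i phi_n, which are test functions themselves; if v is null then g is
orthogonal to all test functions, hence to itself. To run this argument test
functions must be square integrable on the domain, which rests on the
measurability of continuous functions for the coordinate sigma-algebra
([open_measurable_row]) and on the finite measure of a bounded polytope. *)

(** * Borel sets of the space of row vectors *)

Section borel.
Context {R : realType} {d : nat}.
Implicit Types (A : 'I_d -> set (measurableTypeR R)) (Om : set 'rV[R]_d).

Lemma measurable_row_box A : (forall i, measurable (A i)) ->
  measurable [set x : 'rV[R]_d | forall i, A i (x ord0 i)].
Proof.
move=> mA.
rewrite (_ : mkset _ = \bigcap_(i in setT)
    ((fun x : 'rV[R]_d => x ord0 i) @^-1` A i)).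
  apply: fin_bigcap_measurable => // i _.
  by have := measurable_coord i measurableT (mA i); rewrite setTI.
by apply/seteqP; split=> x /= H i; [move=> _; exact: H|exact: (H i I)].
Qed.

(** An open set is the union of the countably many boxes with rational corners
that it contains. *)
Lemma open_measurable_row (U : set 'rV[R]_d) : open U -> measurable U.
Proof.
move=> oU.
pose box (q : 'rV[rat]_d * 'rV[rat]_d) := [set x : 'rV[R]_d |
  forall i, [set` `]ratr (q.1 ord0 i), ratr (q.2 ord0 i)[] (x ord0 i)].
pose F q := if `[< box q `<=` U >] then box q else set0.
rewrite (_ : U = \bigcup_q F q).
  apply: countable_bigcupT_measurable => [|q]; first exact: countableP.
  rewrite /F; case: ifPn => _; last exact: measurable0.
  apply: (@measurable_row_box (fun i =>
    [set` `]ratr (q.1 ord0 i), ratr (q.2 ord0 i)[])) => i.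
  exact: measurable_itv.
apply/seteqP; split=> [x Ux|x [q _]]; last first.
  by rewrite /F; case: ifPn => [/asboolP qU|//]; exact: qU.
have /nbhs_ballP[e /= e0 xeU] := oU x Ux.
have lo i : {q : rat | ratr q \in `]x ord0 i - e, x ord0 i[}.
  by apply/cid/rat_in_itvoo; rewrite ltrBlDr ltrDl.
have hi i : {q : rat | ratr q \in `]x ord0 i, x ord0 i + e[}.
  by apply/cid/rat_in_itvoo; rewrite ltrDl.
exists (\row_i sval (lo i), \row_i sval (hi i)) => //.
rewrite /F; case: asboolP => [_ i /=|]; last first.
  case=> y yq; apply: xeU; split=> // i j; rewrite ord1; have := yq j => /=.
  rewrite !mxE !in_itv /=.
  case: (lo j) (hi j) => a /= + [b /=]; rewrite !in_itv /=.
  move=> /andP[ea ax] /andP[xb be] /andP[ay yb].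
  by rewrite /ball /= ltr_distlC; apply/andP; split; lra.
rewrite !mxE in_itv/=.
case: (lo i) (hi i) => a /= + [b /=]; rewrite !in_itv /=.
by move=> /andP[_ ->] /andP[-> _].
Qed.

Lemma continuous_measurable_row (f : 'rV[R]_d -> R) :
  continuous f -> measurable_fun [set: 'rV[R]_d] f.
Proof.
move=> /continuousP cf mT.
apply: (measurability _ (RGenOInfty.measurableE R)) => //.
move=> _ [_ [x ->] <-]; rewrite setTI; apply: open_measurable_row.
exact/cf/interval_open.
Qed.

Lemma polytope_measurable Om : convex_polytope_domain Om -> measurable Om.
Proof.
move=> [_ _ [m [a [b ->]]]].
rewrite (_ : mkset _ = \bigcap_(i in setT)
    ((fun x => dotp (a i) x) @^-1` `]-oo, b i[%classic)).
  apply: fin_bigcap_measurable => // i _.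
  have mf : measurable_fun [set: 'rV[R]_d] (fun x => dotp (a i) x).
    apply: measurable_sum => j; apply: measurable_funM => //.
    exact: measurable_coord.
  have := mf measurableT _ (measurable_itv `]-oo, b i[).
  by rewrite setTI; apply.
apply/seteqP; split=> x /= H i; first by move=> _; rewrite /= in_itv/=.
by have := H i I; rewrite /= in_itv.
Qed.

Lemma polytope_finite_measure Om : convex_polytope_domain Om ->
  (lebesgue_row d Om < +oo)%E.
Proof.
move=> pOm; have mOm := polytope_measurable pOm.
case: pOm => _ [r [_ Omr]] _.
(* The maximum norm is at most r + 1 on Om: r itself is only an excluded lower
   end for the bounds. *)
pose A (i : 'I_d) : set (measurableTypeR R) := `[- (r + 1), r + 1]%classic.
have mA i : measurable (A i) by exact: measurable_itv.
apply: (@le_lt_trans _ _ (lebesgue_row d [set x | forall i, A i (x ord0 i)])).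
  apply: le_measure; rewrite ?inE//; first exact: measurable_row_box.
  move=> x Omx i; rewrite /A /= in_itv /= -ler_norml.
  have : `|x| <= r + 1 by apply: Omr => //; rewrite ltrDl.
  apply: le_trans.
  rewrite [leRHS]/Num.norm /= mx_normrE.
  exact: (le_bigmax _ (fun ij => `|x ij.1 ij.2|) (ord0, i)).
rewrite lebesgue_row_box//.
have fin : (\prod_(i < d) lebesgue_measure (A i))%E \is a fin_num.
  elim/big_ind: _ => [//|x y|i _]; first exact: fin_numM.
  by rewrite lebesgue_measure_itv /=; case: ifP.
by rewrite -(fineK fin) ltry.
Qed.

End borel.

(** * Semi-inner products and the backward difference energy *)

(** Positivity is asked for everywhere and linearity only on X, because the
integral forms on function spaces are total: they are nonnegative on all
functions, and bilinear only where products are integrable. *)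
Definition semi_inner (R : realType) (V : lmodType R) (X : set V)
    (B : V -> V -> R) :=
  [/\ forall a u v, X u -> X v -> X (a *: u + v),
      forall u v, B u v = B v u,
      forall a u v w, X u -> X v -> X w ->
        B (a *: u + v) w = a * B u w + B v w &
      forall u, 0 <= B u u].

Section semi_inner_theory.
Context {R : realType} {V : lmodType R} (X : set V) (B : V -> V -> R).
Hypothesis XB : semi_inner X B.

Let X0 u : X u -> X 0.
Proof.
by case: XB => lin _ _ _ Xu; rewrite -(addNr u) -scaleN1r; exact: lin.
Qed.

Let XZ a u : X u -> X (a *: u).
Proof.
move=> Xu; rewrite -[_ *: _]addr0; case: XB => + _ _ _; apply => //.
exact: X0 Xu.
Qed.

Let XD u v : X u -> X v -> X (u + v).
Proof. by move=> Xu Xv; rewrite -[u]scale1r; case: XB => + _ _ _; apply. Qed.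

Let B0l w : X w -> B 0 w = 0.
Proof.
case: XB => _ _ lin _ Xw; have X00 := X0 Xw.
have := lin 1 0 0 w X00 X00 Xw; rewrite scale1r addr0 mul1r.
by move/eqP; rewrite addrC -subr_eq subrr eq_sym => /eqP.
Qed.

Let BDl u v w : X u -> X v -> X w -> B (u + v) w = B u w + B v w.
Proof.
by case: XB => _ _ lin _ Xu Xv Xw; rewrite -{1}[u]scale1r lin // mul1r.
Qed.

Let BZl a u w : X u -> X w -> B (a *: u) w = a * B u w.
Proof.
case: XB => _ _ lin _ Xu Xw.
by rewrite -[a *: u]addr0 lin ?B0l ?addr0//; exact: X0 Xu.
Qed.

Let Bsym u v : B u v = B v u. Proof. by case: XB. Qed.

Let BDr u v w : X u -> X v -> X w -> B w (u + v) = B w u + B w v.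
Proof. by move=> Xu Xv Xw; rewrite Bsym BDl// !(Bsym w). Qed.

Let BZr a u w : X u -> X w -> B w (a *: u) = a * B w u.
Proof. by move=> Xu Xw; rewrite Bsym BZl// (Bsym w). Qed.

(** Only semi-definiteness is available, so a degenerate u needs its own
argument: the form is then affine and bounded below along u. *)
Lemma semi_inner_CS u v : X u -> X v -> B u v ^+ 2 <= B u u * B v v.
Proof.
move=> Xu Xv; have Bge0 w : 0 <= B w w by case: XB.
have q s t : 0 <= s ^+ 2 * B u u + 2 * s * t * B u v + t ^+ 2 * B v v.
  have := Bge0 (s *: u + t *: v).
  have Xw := XD (XZ s Xu) (XZ t Xv).
  rewrite (BDl (XZ s Xu) (XZ t Xv) Xw) !BZl//.
  rewrite !(BDr (XZ s Xu) (XZ t Xv))// !BZr//.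
  rewrite (Bsym v u) => /le_trans; apply; rewrite le_eqVlt; apply/orP; left.
  by apply/eqP; ring.
have [u0|] := eqVneq (B u u) 0; last first.
  move=> u0; have {u0}ugt0 : 0 < B u u by rewrite lt_neqAle eq_sym u0 Bge0.
  (* The value at the minimum of the quadratic function t |-> |t u + v|^2, up
     to the factor |u|^2 that clears denominators. *)
  have := q (B u v) (- B u u).
  rewrite (_ : _ + _ = B u u * (B u u * B v v - B u v ^+ 2)); last by ring.
  by rewrite pmulr_rge0// subr_ge0.
rewrite u0 mul0r; have [->|b0] := eqVneq (B u v) 0; first by rewrite expr0n.
(* This coefficient makes the affine function take the value -1. *)
have := q (- (B v v + 1) / (2 * B u v)) 1.
rewrite u0 (_ : _ + _ = -1); first by rewrite lerNr oppr0 ler10.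
by field.
Qed.

Lemma semi_inner_normM u v : X u -> X v ->
  `|B u v| <= Num.sqrt (B u u) * Num.sqrt (B v v).
Proof.
move=> Xu Xv; have Bge0 w : 0 <= B w w by case: XB.
rewrite -sqrtrM// -sqrtr_sqr ler_wsqrtr//.
exact: semi_inner_CS.
Qed.

(** The discrete energy (up to a factor) for which the second order backward
difference scheme is dissipative: the G-norm of the pair (z_n, z_(n-1)). *)
Definition bdf2_energy (z : nat -> V) (n : nat) : R :=
  B (z n) (z n) + B (extrapolate z n) (extrapolate z n).

Let B_comb3 (a b c : V) x y z x' y' z' : X a -> X b -> X c ->
  B (x *: a + y *: b + z *: c) (x' *: a + y' *: b + z' *: c) =
  x * x' * B a a + y * y' * B b b + z * z' * B c c +
  (x * y' + y * x') * B a b + (x * z' + z * x') * B a c +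
  (y * z' + z * y') * B b c.
Proof.
move=> Xa Xb Xc; set w := x' *: a + y' *: b + z' *: c.
have Xw : X w by apply: XD; [apply: XD|]; exact: XZ.
have Bw t : X t -> B t w = x' * B t a + y' * B t b + z' * B t c.
  move=> Xt; rewrite /w (BDr (XD (XZ _ Xa) (XZ _ Xb)) (XZ _ Xc) Xt).
  by rewrite (BDr (XZ _ Xa) (XZ _ Xb) Xt) !BZr.
rewrite (BDl (XD (XZ _ Xa) (XZ _ Xb)) (XZ _ Xc) Xw).
rewrite (BDl (XZ _ Xa) (XZ _ Xb) Xw) !BZl// !Bw//.
by rewrite (Bsym b a) (Bsym c a) (Bsym c b); ring.
Qed.

(** The defect in this inequality is |z_(n+1) - 2 z_n + z_(n-1)|^2. *)
Lemma bdf2_energy_step (z : nat -> V) (n : nat) :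
  (forall m, (n.-1 <= m <= n.+1)%N -> X (z m)) ->
  bdf2_energy z n.+1 - bdf2_energy z n <= 2 * B (bdf2 z n) (z n.+1).
Proof.
move=> Xz.
have [Xa Xb Xc] : [/\ X (z n.+1), X (z n) & X (z n.-1)].
  have nS : (n.-1 <= n.+1)%N := leq_trans (leq_pred n) (leqnSn n).
  by split; apply: Xz; rewrite ?nS ?leqnn ?leq_pred ?leqnSn.
rewrite /bdf2_energy /extrapolate /bdf2 /=.
move: (z n.+1) (z n) (z n.-1) Xa Xb Xc => a b c Xa Xb Xc.
have : 0 <= B (1 *: a + (-2) *: b + 1 *: c) (1 *: a + (-2) *: b + 1 *: c).
  by case: XB.
(* All arguments become combinations of a, b and c, so that one expansion
   formula applies throughout. *)
have Ea : a = 1 *: a + 0 *: b + 0 *: c by rewrite !scale0r !addr0 scale1r.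
have E2ab : 2 *: a - b = 2 *: a + (-1) *: b + 0 *: c.
  by rewrite scale0r addr0 scaleN1r.
have E2bc : 2 *: b - c = 0 *: a + 2 *: b + (-1) *: c.
  by rewrite scale0r add0r scaleN1r.
have Ebdf : 3 *: a - 4 *: b + c = 3 *: a + (-4) *: b + 1 *: c.
  by rewrite scaleNr scale1r.
rewrite E2ab E2bc Ebdf.
have -> : B (3 *: a + (-4) *: b + 1 *: c) a =
    B (3 *: a + (-4) *: b + 1 *: c) (1 *: a + 0 *: b + 0 *: c) by rewrite -Ea.
rewrite !B_comb3//; lra.
Qed.

End semi_inner_theory.

Lemma young_ineq (R : realFieldType) (k x y : R) :
  0 < k -> 2 * (x * y) <= k * x ^+ 2 + k^-1 * y ^+ 2.
Proof.
move=> k0; rewrite -subr_ge0.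
rewrite (_ : _ - _ = k^-1 * (k * x - y) ^+ 2).
  by rewrite mulr_ge0 ?invr_ge0 ?sqr_ge0 // ltW.
by field; rewrite gt_eqF.
Qed.

Lemma sum_increments_le (R : realDomainType) (E D S : nat -> R) (m : nat) :
  (1 <= m)%N ->
  (forall n, (1 <= n < m)%N -> E n.+1 + D n <= E n + S n) ->
  E m + \sum_(1 <= n < m) D n <= E 1%N + \sum_(1 <= n < m) S n.
Proof.
elim: m => [//|[|m] IH _ step]; first by rewrite !big_geq.
rewrite [X in _ + X <= _]big_nat_recr //= [X in _ <= _ + X]big_nat_recr //=.
have : E m.+1 + \sum_(1 <= n < m.+1) D n <= E 1%N + \sum_(1 <= n < m.+1) S n.
  by apply: IH => // n /andP[n0 nm]; apply: step; rewrite n0 ltnW.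
have := step m.+1; rewrite ltnSn => /(_ isT).
lra.
Qed.

(** The abstract energy estimate: each step costs 2 k dt a_n^2, once Young's
inequality has absorbed the load a_n g_n in half of the dissipation. *)
Lemma bdf2_stability (R : realType) (V : lmodType R) (X : set V)
    (B : V -> V -> R) (z : nat -> V) (g a : nat -> R) (dt k : R) (m : nat) :
  semi_inner X B -> 0 < dt -> 0 < k -> (1 <= m)%N ->
  (forall n, (n <= m)%N -> X (z n)) ->
  (forall n, (1 <= n < m)%N ->
    (2 * dt)^-1 * B (bdf2 z n) (z n.+1) + k^-1 * g n ^+ 2 <= a n * g n) ->
  bdf2_energy B z m + 2 * k^-1 * dt * (\sum_(1 <= n < m) g n ^+ 2) <=
  bdf2_energy B z 1 + 2 * k * dt * (\sum_(1 <= n < m) a n ^+ 2).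
Proof.
move=> XB dt0 k0 m1 Xz step.
rewrite 2!mulr_sumr.
apply: sum_increments_le => // n n1m.
have Xzn i : (n.-1 <= i <= n.+1)%N -> X (z i).
  by case/andP: n1m => _ nm /andP[_ im]; apply: Xz; exact: leq_trans im nm.
have energy_step := bdf2_energy_step XB Xzn.
(* The factor 4 dt turns (2 dt)^-1 into the 2 of the energy inequality. *)
have : 4 * dt * ((2 * dt)^-1 * B (bdf2 z n) (z n.+1) + k^-1 * g n ^+ 2) <=
    4 * dt * (a n * g n) by rewrite ler_pM2l ?mulr_gt0// step.
have dtE : 4 * dt * (2 * dt)^-1 = 2 by field; rewrite gt_eqF.
rewrite mulrDr [4 * dt * ((2 * dt)^-1 * _)]mulrA dtE.
have : 2 * dt * (2 * (a n * g n)) <= 2 * dt * (k * a n ^+ 2 + k^-1 * g n ^+ 2).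
  by rewrite ler_pM2l ?mulr_gt0// young_ineq.
lra.
Qed.

(** * Square integrable functions and their weak gradients *)

Section l2.
Context {R : realType} {d : nat} (Om : set 'rV[R]_d).
Hypothesis mOm : measurable Om.
Local Notation mu := (lebesgue_row d).
Implicit Types f g v w phi : 'rV[R]_d -> R.
Implicit Types U V : 'rV[R]_d -> 'rV[R]_d.

Let integrable_realD f g : mu.-integrable Om (EFin \o f) ->
  mu.-integrable Om (EFin \o g) ->
  mu.-integrable Om (EFin \o (fun x => f x + g x)).
Proof. by move=> fi gi; exact: (integrableD mOm fi gi). Qed.

Let integrable_realZ (a : R) f : mu.-integrable Om (EFin \o f) ->
  mu.-integrable Om (EFin \o (fun x => a * f x)).
Proof. by move=> fi; exact: (integrableZl mOm a fi). Qed.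

(** By domination: 2 |f g| <= f^2 + g^2. *)
Lemma L2_integrableM f g : L2 Om f -> L2 Om g ->
  mu.-integrable Om (EFin \o (fun x => f x * g x)).
Proof.
move=> [mf f2] [mg g2].
have intS := integrable_realD f2 g2.
apply: (le_integrable mOm _ _ intS).
- by apply/measurable_EFinP; exact: measurable_funM.
- move=> x _; rewrite /= lee_fin.
  rewrite [leRHS]ger0_norm ?addr_ge0 ?sqr_ge0// ler_norml.
  have := sqr_ge0 (f x - g x); have := sqr_ge0 (f x + g x).
  have := sqr_ge0 (f x); have := sqr_ge0 (g x).
  rewrite !sqrrD sqrrN mulrN => ? ? ? ?.
  by apply/andP; split; lra.
Qed.

Lemma L2_lin (a : R) f g : L2 Om f -> L2 Om g -> L2 Om (a *: f + g).
Proof.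
move=> Lf Lg; have [mf f2] := Lf; have [mg g2] := Lg; split.
  by apply: measurable_funD => //; exact: measurable_funM.
have -> : (fun x => (a *: f + g) x ^+ 2) =
  (fun x => a ^+ 2 * f x ^+ 2 + (a * 2 * (f x * g x) + g x ^+ 2)).
  by apply/funext => x; rewrite !fctE /= /GRing.scale /=; ring.
apply: integrable_realD; first exact: integrable_realZ.
apply: integrable_realD => //; apply: integrable_realZ.
exact: L2_integrableM.
Qed.

Lemma ip_semi_inner : semi_inner (L2 Om) (ip Om).
Proof.
split=> [|f g|a f g h Lf Lg Lh|f].
- exact: L2_lin.
- by apply: eq_Rintegral => x _; rewrite mulrC.
- rewrite /ip -RintegralZl//; last exact: L2_integrableM.
  rewrite -RintegralD//; last 2 first.
  + by apply: integrable_realZ; exact: L2_integrableM.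
  + exact: L2_integrableM.
  by apply: eq_Rintegral => x _; rewrite !fctE mulrDl mulrA.
- by apply: Rintegral_ge0 => x _; exact: sqr_ge0.
Qed.

Lemma vip_semi_inner : semi_inner (vfields (L2 Om)) (vip Om).
Proof.
have [lin sym add pos] := ip_semi_inner.
have compD a U V i :
    component (a *: U + V) i = a *: component U i + component V i.
  by apply/funext => x; rewrite /component !fctE !mxE.
split=> [a U V LU LV i|U V|a U V W LU LV LW|U].
- by rewrite compD; exact: lin.
- by apply: eq_bigr => i _; exact: sym.
- rewrite /vip mulr_sumr -big_split; apply: eq_bigr => i _.
  by rewrite compD add.
- by apply: sumr_ge0 => i _; exact: pos.
Qed.

Lemma l2normM f g : L2 Om f -> L2 Om g ->
  `|ip Om f g| <= l2norm Om f * l2norm Om g.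
Proof. by move=> Lf Lg; exact: (semi_inner_normM ip_semi_inner Lf Lg). Qed.

Lemma l2norm_sqr f : l2norm Om f ^+ 2 = ip Om f f.
Proof. by rewrite sqr_sqrtr//; case: ip_semi_inner. Qed.

Lemma vnorm_sqr U : vnorm Om U ^+ 2 = vip Om U U.
Proof. by rewrite sqr_sqrtr//; case: vip_semi_inner. Qed.

Lemma gradip_ge0 v : 0 <= gradip Om v v.
Proof. by apply: sumr_ge0 => i _; case: ip_semi_inner. Qed.

Lemma gradnorm_sqr v : gradnorm Om v ^+ 2 = gradip Om v v.
Proof. by rewrite sqr_sqrtr// gradip_ge0. Qed.

Lemma vgradnorm_sqr U : vgradnorm Om U ^+ 2 = vgradip Om U U.
Proof. by rewrite sqr_sqrtr//; apply: sumr_ge0 => i _; exact: gradip_ge0. Qed.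

Lemma H1_wpartial i v : H1 Om v -> is_weak_partial Om i v (wpartial Om i v).
Proof. by move=> [_ /(_ i)[g gv]]; by apply: xgetPex; exists g. Qed.

(** The support stays in K because the complement of K is open. *)
Lemma test_fun_partial i phi : test_fun Om phi -> test_fun Om (partial i phi).
Proof.
move=> [dphi [K cK [KOm phi0]]]; split=> [s x|].
  by have := dphi (rcons s i) x; rewrite foldr_rcons.
exists K => //; split=> // x nKx.
have -> : partial i phi x = partial i (cst 0) x.
  apply: near_eq_derive; have cl : closed K.
    by apply: compact_closed => //; exact: norm_hausdorff.
  have : open (~` K) by rewrite openC.
  by move=> /(_ x nKx); apply: filterS => y /phi0.
by rewrite /partial derive_cst.
Qed.

Lemma test_fun_L2 phi : (mu Om < +oo)%E -> test_fun Om phi -> L2 Om phi.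
Proof.
move=> finOm [dphi [K cK [KOm phi0]]].
have cphi : continuous phi.
  by move=> x; apply: differentiable_continuous; exact: dphi [::] x.
have mphi : measurable_fun Om phi.
  by apply: measurable_funTS; exact: continuous_measurable_row.
split=> //; apply: measurable_bounded_integrable => //.
  exact: measurable_funX.
have [M [_ HM]] : bounded_set (phi @` K).
  apply: compact_bounded; apply: continuous_compact => //.
  exact: continuous_subspaceT.
exists ((`|M| + 1) ^+ 2); split; first exact: num_real.
move=> t Mt x Omx /=; apply: (le_trans _ (ltW Mt)).
rewrite normrX ler_sqr ?nnegrE ?addr_ge0//.
have [Kx|nKx] := pselect (K x); last by rewrite phi0// normr0 addr_ge0.
apply: HM; last by exists x.
by rewrite (le_lt_trans (ler_norm _))// ltrDl.
Qed.

(** A weak derivative of a null function is orthogonal to all test functions.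
For v in the closure of the test functions it is also a limit of test functions,
so it is orthogonal to itself. *)
Lemma gradnorm_null v : (mu Om < +oo)%E -> H01 Om v ->
  l2norm Om v = 0 -> gradnorm Om v = 0.
Proof.
move=> finOm [H1v [phi [tphi _ dphi]]] v0; have Lv : L2 Om v by case: H1v.
rewrite /gradnorm /gradip big1 ?sqrtr0// => i _.
have [Lg gE] := H1_wpartial i H1v; set g := wpartial Om i v in Lg gE *.
have tdphi n := test_fun_partial i (tphi n).
have Ldphi n := test_fun_L2 finOm (tdphi n).
(* As d_i phi_n is a test function, (g, d_i phi_n) = - (v, d_i d_i phi_n), and v
   is null. *)
have orth n : ip Om g (partial i (phi n)) = 0.
  apply/eqP; rewrite -oppr_eq0 -gE// -normr_le0.
  apply: (le_trans (l2normM Lv _)); last by rewrite v0 mul0r.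
  exact: test_fun_L2 (test_fun_partial _ (tdphi n)).
have bnd n : ip Om g g <= l2norm Om g * l2norm Om (partial i (phi n) - g).
  have [lin sym add pos] := ip_semi_inner.
  have Ldiff : L2 Om (partial i (phi n) - g).
    by rewrite addrC -scaleN1r; exact: lin.
  apply: le_trans (l2normM Lg Ldiff).
  rewrite addrC -scaleN1r sym add// (sym _ g) orth addr0 mulN1r normrN.
  exact: ler_norm.
apply/eqP; rewrite eq_le; apply/andP; split; last by case: ip_semi_inner.
have cv : l2norm Om g * l2norm Om (partial i (phi n) - g) @[n --> \oo] -->
    l2norm Om g * 0 by apply: cvgMr; exact: dphi.
rewrite mulr0 in cv; rewrite -(cvg_lim _ cv)//.
apply: limr_ge; first by apply/cvg_ex; exists 0.
exact: nearW.
Qed.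

End l2.

Lemma vgradnorm_null (R : realType) (d : nat) (Om : set 'rV[R]_d)
    (V : 'rV[R]_d -> 'rV[R]_d) :
  measurable Om -> (lebesgue_row d Om < +oo)%E -> vfields (H01 Om) V ->
  vnorm Om V = 0 -> vgradnorm Om V = 0.
Proof.
move=> mOm finOm HV V0; have [_ _ _ pos] := ip_semi_inner mOm.
have /eqP : vip Om V V = 0 by rewrite -vnorm_sqr// V0 expr0n.
rewrite psumr_eq0 => [/allP V0i|i _]; last exact: pos.
rewrite /vgradnorm /vgradip big1 ?sqrtr0// => i _.
rewrite -gradnorm_sqr// gradnorm_null ?expr0n//.
by rewrite /l2norm (eqP (V0i i (mem_index_enum _))) sqrtr0.
Qed.

(** * Loads tested against the new time level *)

(** The supremum that defines the dual norm leaves out the v with [nrm v = 0];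
they obey the bound because their gradient vanishes. *)
Lemma dual_norm_bound (R : realType) (V : lmodType R) (X : set V)
    (nrm gn : V -> R) (f : V -> R) (v : V) :
  (forall w, 0 <= gn w) -> (nrm v = 0 -> gn v = 0) ->
  dual_space X gn f -> X v -> `|f v| <= dual_norm X nrm gn f * gn v.
Proof.
move=> gn0 nullv [_ [C fC]] Xv.
have [gv|gv] := eqVneq (gn v) 0.
  by have := fC v Xv; rewrite gv !mulr0.
have gv0 : 0 < gn v by rewrite lt_neqAle eq_sym gv gn0.
rewrite -ler_pdivrMr//; apply: ub_le_sup; last first.
  by exists v => //; split=> //; apply: contraNN gv => /eqP/nullv ->.
exists (Num.max C 0) => _ [w [Xw _] <-].
have [->|w0] := eqVneq (gn w) 0.
  by rewrite invr0 mulr0 le_max lexx orbT.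
by rewrite le_max ler_pdivrMr ?fC// lt_neqAle eq_sym w0 gn0.
Qed.

(** Only the last component of [theta *: khat] is nonzero. *)
Lemma buoyancy_bound (R : realType) (d : nat) (Om : set 'rV[R]_d)
    (theta : 'rV[R]_d -> R) (V : 'rV[R]_d -> 'rV[R]_d) :
  measurable Om -> (0 < d)%N -> L2 Om theta -> vfields (L2 Om) V ->
  `|vip Om (fun x => theta x *: khat) V| <= l2norm Om theta * vnorm Om V.
Proof.
case: d => [//|d] in Om theta V * => mOm _ Ltheta LV.
have [_ _ _ pos] := ip_semi_inner mOm.
rewrite /vip big_ord_recr /= big1 ?add0r; last first.
  move=> i _.
  rewrite /ip (@eq_Rintegral _ _ _ _ _ (cst 0)) ?Rintegral_cst ?mul0r// => x _.
  by rewrite /component !mxE /= eqSS ltn_eqF// mulr0 mul0r.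
have -> : component (fun x => theta x *: khat) ord_max = theta.
  by apply/funext => x; rewrite /component !mxE eqxx mulr1.
apply: le_trans (l2normM mOm Ltheta (LV ord_max)) _.
rewrite ler_wpM2l ?sqrtr_ge0// ler_wsqrtr// /vip big_ord_recr /=.
by rewrite lerDr sumr_ge0.
Qed.

Lemma cform_skew (R : realType) (d : nat) (Om : set 'rV[R]_d) U theta :
  cform Om U theta theta = 0.
Proof. by rewrite /cform subrr mulr0. Qed.

Lemma bform_skew (R : realType) (d : nat) (Om : set 'rV[R]_d) U V :
  bform Om U V V = 0.
Proof. by rewrite /bform subrr mulr0. Qed.

Lemma ler_sum_shift (R : realDomainType) (F : nat -> R) (m M : nat) :
  (forall n, 0 <= F n) -> (m <= M)%N ->
  \sum_(1 <= n < m) F n <= \sum_(0 <= n < M) F n.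
Proof.
move=> F0 mM.
rewrite [leRHS](big_cat_nat (n := m)) //=.
case: m mM => [|m] mM; first by rewrite big_geq// addr_ge0// sumr_ge0.
by rewrite [in leRHS]big_ltn //= addrAC lerDr addr_ge0// sumr_ge0.
Qed.

(** * The energy estimate for the scheme *)

(** The loads enter only through coefficients that bound them by the gradient
norm, one for each time level; dual norms are one choice of them. *)
Section scheme_energy.
Context {R : realType} {d : nat} (Om : set 'rV[R]_d).
Variables (Re Ri Pr CP alpha dt : R) (N M : nat).
Variables (Sh Qh Yh : set ('rV[R]_d -> R)).
Variables (f : R -> ('rV[R]_d -> 'rV[R]_d) -> R).
Variables (gamma : R -> ('rV[R]_d -> R) -> R).
Variables (u : nat -> 'rV[R]_d -> 'rV[R]_d) (p T : nat -> 'rV[R]_d -> R).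
Variables (fnorm gammanorm : nat -> R).
Hypotheses (mOm : measurable Om) (d0 : (0 < d)%N) (Re0 : 0 < Re) (Pr0 : 0 < Pr).
Hypotheses (poinc : poincare Om CP) (dt0 : 0 < dt) (M1 : (1 <= M)%N).
Hypotheses (SH01 : Sh `<=` H01 Om) (YH01 : Yh `<=` H01 Om).
Hypothesis f_bound : forall n v, (n < M)%N -> vfields (H01 Om) v ->
  `|f (n.+1%:R * dt) v| <= fnorm n.+1 * vgradnorm Om v.
Hypothesis gamma_bound : forall n s, (n < M)%N -> H01 Om s ->
  `|gamma (n.+1%:R * dt) s| <= gammanorm n.+1 * gradnorm Om s.
Hypotheses (u0S : vfields Sh (u 0%N)) (u1S : vfields Sh (u 1%N)).
Hypotheses (T0Y : Yh (T 0%N)) (T1Y : Yh (T 1%N)).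
Hypothesis scheme :
  leray_boussinesq_bdf2 Om Re Ri Pr alpha N Sh Qh Yh dt M f gamma u p T.

Let H01L2 v : H01 Om v -> L2 Om v. Proof. by case=> -[]. Qed.

Let TH n : (n <= M)%N -> H01 Om (T n).
Proof.
move=> nM; apply: YH01; case: n nM => [//|[//|n]] nM.
by have [] := scheme (n := n.+1) nM.
Qed.

Let uH n : (n <= M)%N -> vfields (H01 Om) (u n).
Proof.
move=> nM i; apply: SH01; case: n nM => [_|[_|n nM]].
- exact: u0S.
- exact: u1S.
- by have [] := scheme (n := n.+1) nM.
Qed.

Let TL2 n : (n <= M)%N -> L2 Om (T n).
Proof. by move=> nM; exact/H01L2/TH. Qed.

Let uL2 n : (n <= M)%N -> vfields (L2 Om) (u n).
Proof. by move=> nM i; exact/H01L2/uH. Qed.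

Let extL2 n : (n <= M)%N -> L2 Om (extrapolate T n).
Proof.
move=> nM; have [lin _ _ _] := ip_semi_inner mOm.
rewrite /extrapolate -scaleN1r addrC; apply: (lin).
  exact/TL2/(leq_trans (leq_pred n)).
rewrite scaler_nat mulr2n -{1}[T n]scale1r.
by apply: lin; exact: TL2.
Qed.

(** The temperature equation is tested with T_(n+1), so that convection drops
out and the heat source is the only load. *)
Lemma temperature_stability m : (1 <= m <= M)%N ->
  bdf2_energy (ip Om) T m
    + 2 * (Re * Pr)^-1 * dt * (\sum_(1 <= n < m) gradnorm Om (T n.+1) ^+ 2) <=
  bdf2_energy (ip Om) T 1
    + 2 * (Re * Pr) * dt * (\sum_(1 <= n < m) gammanorm n.+1 ^+ 2).
Proof.
move=> /andP[m1 mM]; have ReP0 : 0 < Re * Pr by exact: mulr_gt0.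
apply: (bdf2_stability (ip_semi_inner mOm)) => // [n nm|n /andP[n1 nm]].
  exact/TL2/(leq_trans nm).
have nM : (n < M)%N := leq_trans nm mM.
have [uS pQ TY eqs] := scheme (introT andP (conj n1 nM)).
have [eqT _ _] := eqs _ _ _ uS pQ TY.
have -> : (2 * dt)^-1 * ip Om (bdf2 T n) (T n.+1)
    + (Re * Pr)^-1 * gradnorm Om (T n.+1) ^+ 2 = gamma (n.+1%:R * dt) (T n.+1).
  by rewrite -eqT cform_skew addr0 gradnorm_sqr.
by apply: le_trans (ler_norm _) _; apply: gamma_bound => //; exact: TH.
Qed.

Let CT := bdf2_energy (ip Om) T 1
  + 2 * (Re * Pr) * dt * (\sum_(0 <= n < M) gammanorm n.+1 ^+ 2).

Lemma temperature_bound m : (1 <= m <= M)%N ->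
  bdf2_energy (ip Om) T m
    + 2 * (Re * Pr)^-1 * dt * (\sum_(1 <= n < m) gradnorm Om (T n.+1) ^+ 2)
  <= CT.
Proof.
move=> m1M; apply: le_trans (temperature_stability m1M) _.
rewrite lerD2l ler_wpM2l//; first by rewrite !mulr_ge0// ltW.
by case/andP: m1M => _; apply: ler_sum_shift => n; exact: sqr_ge0.
Qed.

(** The extrapolated temperature is one of the two terms of the energy; hence
this choice of energy controls the buoyancy without any Gronwall argument. *)
Lemma extrapolation_bound n : (1 <= n <= M)%N ->
  l2norm Om (extrapolate T n) ^+ 2 <= CT.
Proof.
move=> n1M; apply: le_trans (temperature_bound n1M).
rewrite l2norm_sqr// /bdf2_energy -addrA [leRHS]addrCA lerDl.
have [_ _ _ pos] := ip_semi_inner mOm.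
rewrite addr_ge0// !mulr_ge0 ?invr_ge0 ?(ltW (mulr_gt0 _ _)) ?(ltW dt0)//.
by apply: sumr_ge0 => i _; exact: sqr_ge0.
Qed.

(** Tested with u_(n+1), the momentum equation loses its pressure term too, and
the Poincare inequality turns the buoyancy into a load on the gradient. *)
Lemma velocity_stability :
  bdf2_energy (vip Om) u M
    + 2 * Re^-1 * dt * (\sum_(1 <= n < M) vgradnorm Om (u n.+1) ^+ 2) <=
  bdf2_energy (vip Om) u 1
    + 2 * Re * dt * (\sum_(1 <= n < M)
        (fnorm n.+1 + `|Ri| * CP * l2norm Om (extrapolate T n)) ^+ 2).
Proof.
apply: (bdf2_stability (vip_semi_inner mOm)) => // n /andP[n1 nM].
have [uS pQ TY eqs] := scheme (introT andP (conj n1 nM)).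
have [_ equ eqp] := eqs _ _ _ uS pQ TY.
have [_ sym _ _] := ip_semi_inner mOm.
rewrite bform_skew sym eqp addr0 subr0 -vgradnorm_sqr// in equ.
have fu : `|f (n.+1%:R * dt) (u n.+1)| <= fnorm n.+1 * vgradnorm Om (u n.+1).
  by apply: f_bound => //; exact: uH.
have := buoyancy_bound mOm d0 (extL2 (ltnW nM)) (uL2 nM).
set bu := vip Om (fun _ => _ *: khat) _ in equ *; move=> bub.
set tau := l2norm Om (extrapolate T n) in bub *.
have tau0 : 0 <= tau by exact: sqrtr_ge0.
have Rib : `|Ri * bu| <= `|Ri| * (tau * (CP * vgradnorm Om (u n.+1))).
  rewrite normrM ler_wpM2l// (le_trans bub)// ler_wpM2l//.
  exact/poinc/uH.
have := le_trans (ler_norm _) fu; have := le_trans (ler_norm _) Rib.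
lra.
Qed.

(** The square of the sum is split by (x + y)^2 <= 2 x^2 + 2 y^2, and the number
of steps turns the uniform buoyancy bound into one proportional to the final
time. *)
Lemma velocity_load_bound :
  \sum_(1 <= n < M)
      (fnorm n.+1 + `|Ri| * CP * l2norm Om (extrapolate T n)) ^+ 2 <=
  2 * (\sum_(0 <= n < M) fnorm n.+1 ^+ 2)
    + 2 * (CP ^+ 2 * Ri ^+ 2 * CT) * M%:R.
Proof.
have CPRi0 : 0 <= CP ^+ 2 * Ri ^+ 2 by rewrite mulr_ge0 ?sqr_ge0.
have CT0 : 0 <= CT.
  by apply: le_trans (extrapolation_bound (n := 1%N) _); rewrite ?M1 ?sqr_ge0.
apply: (@le_trans _ _ (\sum_(1 <= n < M)
    (2 * fnorm n.+1 ^+ 2 + 2 * (CP ^+ 2 * Ri ^+ 2 * CT)))).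
  apply: ler_sum_nat => n /andP[n1 nM].
  set tau := l2norm Om (extrapolate T n).
  have tauCT : CP ^+ 2 * Ri ^+ 2 * tau ^+ 2 <= CP ^+ 2 * Ri ^+ 2 * CT.
    by rewrite ler_wpM2l// extrapolation_bound// n1 ltnW.
  have : (`|Ri| * CP * tau) ^+ 2 = CP ^+ 2 * Ri ^+ 2 * tau ^+ 2.
    by rewrite !exprMn real_normK ?num_real//; ring.
  have := sqr_ge0 (fnorm n.+1 - `|Ri| * CP * tau).
  rewrite sqrrB sqrrD; lra.
rewrite big_split /= -mulr_sumr lerD//.
  by rewrite ler_pM2l//; apply: ler_sum_shift => // n; exact: sqr_ge0.
rewrite sumr_const_nat -[leLHS]mulr_natr ler_wpM2l ?ler_nat ?leq_subr//.
by do 2 apply: mulr_ge0 => //.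
Qed.

Lemma leray_boussinesq_stability :
  vnorm Om (u M) ^+ 2 + l2norm Om (T M) ^+ 2
  + vnorm Om (2 *: u M - u M.-1) ^+ 2
  + l2norm Om (2 *: T M - T M.-1) ^+ 2
  + 2 * Re^-1 * dt * \sum_(1 <= n < M) vgradnorm Om (u n.+1) ^+ 2
  + 2 * (Re * Pr)^-1 * dt * \sum_(1 <= n < M) gradnorm Om (T n.+1) ^+ 2
  <= vnorm Om (u 1%N) ^+ 2 + l2norm Om (T 1%N) ^+ 2
     + vnorm Om (2 *: u 1%N - u 0%N) ^+ 2
     + l2norm Om (2 *: T 1%N - T 0%N) ^+ 2
     + 4 * Re * dt * \sum_(0 <= n < M) fnorm n.+1 ^+ 2
     + 2 * Re * Pr * dt * \sum_(0 <= n < M) gammanorm n.+1 ^+ 2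
     + 4 * CP ^+ 2 * Ri ^+ 2 * Re *
       (l2norm Om (T 1%N) ^+ 2
        + l2norm Om (2 *: T 1%N - T 0%N) ^+ 2
        + 2 * Re * Pr * dt * \sum_(0 <= n < M) gammanorm n.+1 ^+ 2) *
       (M%:R * dt).
Proof.
have Tn n : l2norm Om (T n) ^+ 2 + l2norm Om (2 *: T n - T n.-1) ^+ 2 =
    bdf2_energy (ip Om) T n by rewrite !l2norm_sqr.
have un n : vnorm Om (u n) ^+ 2 + vnorm Om (2 *: u n - u n.-1) ^+ 2 =
    bdf2_energy (vip Om) u n by rewrite !vnorm_sqr.
have CTE : l2norm Om (T 1%N) ^+ 2 + l2norm Om (2 *: T 1%N - T 0%N) ^+ 2
    + 2 * Re * Pr * dt * \sum_(0 <= n < M) gammanorm n.+1 ^+ 2 = CT.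
  by rewrite (Tn 1%N) -(mulrA 2 Re).
rewrite CTE; move: CTE (Tn 1%N) (Tn M) (un 1%N) (un M).
have := temperature_bound (m := M); rewrite M1 leqnn => /(_ isT).
have : 2 * Re * dt * \sum_(1 <= n < M)
      (fnorm n.+1 + `|Ri| * CP * l2norm Om (extrapolate T n)) ^+ 2 <=
    2 * Re * dt * (2 * (\sum_(0 <= n < M) fnorm n.+1 ^+ 2)
      + 2 * (CP ^+ 2 * Ri ^+ 2 * CT) * M%:R).
  by rewrite ler_wpM2l ?velocity_load_bound// !mulr_ge0// ltW.
have := velocity_stability.
(* What remains is linear in the following quantities; naming them keeps the
   integrals out of the arithmetic. *)
rewrite /=.
move: (bdf2_energy _ u M) (bdf2_energy _ u 1) => EuM Eu1.
move: CT (bdf2_energy _ T M) (bdf2_energy _ T 1) => C ETM ET1.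
move: (vnorm Om (u M)) (vnorm Om (2 *: u M - _)) => uM uM'.
move: (vnorm Om (u 1%N)) (vnorm Om (2 *: u 1%N - _)) => u_1 u_1'.
move: (l2norm Om (T M)) (l2norm Om (2 *: T M - _)) => TM TM'.
move: (l2norm Om (T 1%N)) (l2norm Om (2 *: T 1%N - _)) => T_1 T_1'.
move: (\sum_(0 <= n < M) fnorm n.+1 ^+ 2) => SF.
move: (\sum_(0 <= n < M) gammanorm n.+1 ^+ 2) => SG.
move: (\sum_(1 <= n < M) gradnorm Om (T n.+1) ^+ 2) => ST.
move: (\sum_(1 <= n < M) vgradnorm Om (u n.+1) ^+ 2) => SU.
move: (\sum_(1 <= n < M) (fnorm n.+1 + _) ^+ 2) => SQ.
lra.
Qed.

End scheme_energy.

Theorem lemma4p1 (R : realType) (d : nat) (Om : set 'rV[R]_d)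
  (Re Ri Pr CP : R)
  (sigma beta Calpha : R) (k N : nat)
  (h alpha : R) (tau : set (set 'rV[R]_d))
  (Sh Qh Yh : set ('rV[R]_d -> R))
  (dt tstar : R) (M : nat)
  (f : R -> ('rV[R]_d -> 'rV[R]_d) -> R) (gamma : R -> ('rV[R]_d -> R) -> R)
  (u : nat -> 'rV[R]_d -> 'rV[R]_d) (p T : nat -> 'rV[R]_d -> R) :
  (d = 2 \/ d = 3)%N ->
  convex_polytope_domain Om ->
  0 < Re -> 0 < Pr ->
  poincare Om CP ->
  regular_mesh Om sigma h tau ->
  (1 <= k)%N ->
  fe_space (H01 Om) tau k Sh ->
  fe_space (L20 Om) tau k.-1 Qh ->
  fe_space (H01 Om) tau k Yh ->
  0 < beta -> inf_sup Om (vfields Sh) Qh beta ->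
  0 < alpha -> alpha <= Calpha * h ->
  0 < dt -> (1 <= M)%N -> tstar = M%:R * dt ->
  Linfty_dual (vfields (H01 Om)) (vnorm Om) (vgradnorm Om) tstar f ->
  Linfty_dual (H01 Om) (l2norm Om) (gradnorm Om) tstar gamma ->
  disc_div_free Om (vfields Sh) Qh (u 0%N) ->
  disc_div_free Om (vfields Sh) Qh (u 1%N) ->
  Yh (T 0%N) -> Yh (T 1%N) ->
  leray_boussinesq_bdf2 Om Re Ri Pr alpha N Sh Qh Yh dt M f gamma u p T ->
  (forall n, (1 <= n < M)%N ->
     {ae lebesgue_row d, forall x, Om x ->
        filter_indicator Om alpha Sh N (extrapolate u n) x <= 1}) ->
  let fnorm n := dual_norm (vfields (H01 Om)) (vnorm Om) (vgradnorm Om)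
                   (f (n%:R * dt)) in
  let gammanorm n := dual_norm (H01 Om) (l2norm Om) (gradnorm Om)
                       (gamma (n%:R * dt)) in
  let CT := l2norm Om (T 1%N) ^+ 2
            + l2norm Om (2 *: T 1%N - T 0%N) ^+ 2
            + 2 * Re * Pr * dt * \sum_(0 <= n < M) gammanorm n.+1 ^+ 2 in
  vnorm Om (u M) ^+ 2 + l2norm Om (T M) ^+ 2
  + vnorm Om (2 *: u M - u M.-1) ^+ 2
  + l2norm Om (2 *: T M - T M.-1) ^+ 2
  + 2 * Re^-1 * dt * \sum_(1 <= n < M) vgradnorm Om (u n.+1) ^+ 2
  + 2 * (Re * Pr)^-1 * dt * \sum_(1 <= n < M) gradnorm Om (T n.+1) ^+ 2
  <= vnorm Om (u 1%N) ^+ 2 + l2norm Om (T 1%N) ^+ 2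
     + vnorm Om (2 *: u 1%N - u 0%N) ^+ 2
     + l2norm Om (2 *: T 1%N - T 0%N) ^+ 2
     + 4 * Re * dt * \sum_(0 <= n < M) fnorm n.+1 ^+ 2
     + 2 * Re * Pr * dt * \sum_(0 <= n < M) gammanorm n.+1 ^+ 2
     + 4 * CP ^+ 2 * Ri ^+ 2 * Re * CT * tstar.
Proof.
move=> d23 pOm Re0 Pr0 poinc _ _ [_ SH01 _] _ [_ YH01 _] _ _ _ _ dt0 M1 ->.
move=> fdual gdual [u0S _] [u1S _] T0Y T1Y scheme _.
have mOm := polytope_measurable pOm.
have finOm := polytope_finite_measure pOm.
have d0 : (0 < d)%N by case: d23 => ->.
have tM n : (n < M)%N -> 0 < n.+1%:R * dt <= M%:R * dt.
  by move=> nM; rewrite mulr_gt0//= ler_wpM2r ?ler_nat// ltW.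
pose fnorm n := dual_norm (vfields (H01 Om)) (vnorm Om) (vgradnorm Om)
  (f (n%:R * dt)).
pose gammanorm n := dual_norm (H01 Om) (l2norm Om) (gradnorm Om)
  (gamma (n%:R * dt)).
have f_bound n v : (n < M)%N -> vfields (H01 Om) v ->
    `|f (n.+1%:R * dt) v| <= fnorm n.+1 * vgradnorm Om v.
  move=> nM Hv; have [fX _ _] := fdual.
  exact: (dual_norm_bound (fun w => sqrtr_ge0 (vgradip Om w w))
    (vgradnorm_null mOm finOm Hv) (fX _ (tM n nM)) Hv).
have gamma_bound n s : (n < M)%N -> H01 Om s ->
    `|gamma (n.+1%:R * dt) s| <= gammanorm n.+1 * gradnorm Om s.
  move=> nM Hs; have [gX _ _] := gdual.
  exact: (dual_norm_bound (fun w => sqrtr_ge0 (gradip Om w w))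
    (gradnorm_null mOm finOm Hs) (gX _ (tM n nM)) Hs).
exact: (leray_boussinesq_stability mOm d0 Re0 Pr0 poinc dt0 M1 SH01 YH01
  f_bound gamma_bound u0S u1S T0Y T1Y scheme).
Qed.
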